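(* For Jacobi-Jordan algebras with zero multiplication, PJJ-structures correspond to anticommutative antiassociative algebras. That is: if $(A,\circ)$ is a Jacobi-Jordan algebra with $x\circ y=0$ for all $x,y$, then a bilinear product $\star$ on $A$ is a PJJ-structure on $(A,\circ)$ if and only if $(A,\star)$ is anticommutative and antiassociative.
   Context: All algebras are over $\mathbb{C}$. A Jacobi-Jordan algebra is a commutative algebra satisfying $x(yz)+y(zx)+z(xy)=0$. A post-Jacobi-Jordan structure (PJJ-structure) on a Jacobi-Jordan algebra $(A,\circ)$ is a bilinear product $\star$ on $A$ satisfying, for all $x,y,z\in A$: $x\star y=-y\star x$; $x\star(y\circ z)=-\big((x\star y)\circ z+y\circ(x\star z)\big)$; $(x\circ y)\star z=-\big(x\star(y\star z)+y\star(x\star z)\big)$. An algebra $(A,\star)$ is anticommutative if $x\star y+y\star x=0$ for all $x,y$, and antiassociative if $(x\star y)\star z+x\star(y\star z)=0$ for all $x,y,z$. *)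

(* Defs.v *)
From HB Require Import structures.
From mathcomp Require Import all_boot all_order all_algebra.
From mathcomp Require Import complex reals.

Set Implicit Arguments.
Unset Strict Implicit.
Unset Printing Implicit Defensive.

Import GRing.Theory.
Local Open Scope ring_scope.

(* An algebra over K is an lmodType (of arbitrary dimension) together with a
   bilinear product, with no associativity or unit assumed; the product is kept
   as a separate argument because the same space carries several of them. *)

Record jacobi_jordan (K : fieldType) (A : lmodType K)
    (circ : {bilinear A -> A -> A}) : Prop := JacobiJordan {
  jj_comm : forall x y : A, circ x y = circ y x;
  jj_jacobi : forall x y z : A,
    circ x (circ y z) + circ y (circ z x) + circ z (circ x y) = 0
}.

Record pjj_structure (K : fieldType) (A : lmodType K)
    (circ star : {bilinear A -> A -> A}) : Prop := PJJStructure {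
  pjj_anticomm : forall x y : A, star x y = - star y x;
  pjj_antider : forall x y z : A,
    star x (circ y z) = - (circ (star x y) z + circ y (star x z));
  pjj_rep : forall x y z : A,
    star (circ x y) z = - (star x (star y z) + star y (star x z))
}.

Definition anticommutative_alg (K : fieldType) (A : lmodType K)
    (star : {bilinear A -> A -> A}) : Prop :=
  forall x y : A, star x y + star y x = 0.

Definition antiassociative_alg (K : fieldType) (A : lmodType K)
    (star : {bilinear A -> A -> A}) : Prop :=
  forall x y z : A, star (star x y) z + star x (star y z) = 0.

(* Main.v *)
Require Import Defs.
From HB Require Import structures.
From mathcomp Require Import all_boot all_order all_algebra.
From mathcomp Require Import complex reals.

Set Implicit Arguments.
Unset Strict Implicit.
Unset Printing Implicit Defensive.

Import GRing.Theory.
Local Open Scope ring_scope.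

(** When [circ] vanishes, [pjj_antider] reads 0 = 0 and [pjj_rep] says that left multiplications by
    [star] anticommute: x(yz) = -y(xz). For an anticommutative product, this identity is equivalent
    to antiassociativity. *)

Theorem proposition66 (R : realType) (A : lmodType (complex R))
    (circ : {bilinear A -> A -> A}) (hJJ : jacobi_jordan circ)
    (hzero : forall x y : A, circ x y = 0)
    (star : {bilinear A -> A -> A}) :
  pjj_structure circ star <->
  anticommutative_alg star /\ antiassociative_alg star.
Proof.
split=> [[anti _ rep] | [anti assoc]].
  have swap x y z : star x (star y z) = - star y (star x z).
    by apply/eqP; rewrite -addr_eq0 -oppr_eq0 -rep hzero linear0l.
  split=> x y => [|z]; first by rewrite anti addNr.
  (* The chain is (xy)z = -z(xy) = x(zy) = -x(yz). *)
  by rewrite anti swap (anti z y) linearNr /= opprK addNr.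
have antiN x y : star x y = - star y x by apply/eqP; rewrite -addr_eq0 anti.
split=> // x y z; first by rewrite !hzero linear0r addr0 oppr0.
have assocN u v w : star u (star v w) = - star (star u v) w.
  by apply/eqP; rewrite -addr_eq0 addrC assoc.
(* Moving brackets left, x(yz) + y(xz) = -(xy)z - (yx)z, which cancels because yx = -xy. *)
by rewrite hzero linear0l !assocN (antiN y x) linearNl opprK addNr oppr0.
Qed.
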